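(* Let $G$ be a finite group, let $\varphi:G\to G$ be a group endomorphism, and let $(a_k)_{k\in\mathbb{N}^+}$ be the procreation behavior of the identity element $1_G$ in the dual digraph $\Gamma_{\varphi}^{\ast}$ of the state space of $\varphi$. Then for all $k\in\mathbb{N}$, $a_1\cdots a_k=|\mathrm{ker}^{(k)}(\varphi)|$ (in particular, $a_k=[\mathrm{ker}^{(k)}(\varphi):\mathrm{ker}^{(k-1)}(\varphi)]$ for $k\geq 1$), and for all $n,m\in\mathbb{N}^+$, $n\leq m$ implies $a_m\mid a_n$.
   Context: Let $\mathbb{N}$ be the natural numbers including $0$, and $\mathbb{N}^+$ the positive integers. The state space $\Gamma_\varphi$ is the digraph with vertex set $G$ having a directed edge from $x$ to $y$ if and only if $y=\varphi(x)$ (loops allowed). For a digraph $\Gamma=(V,E)$, the dual digraph is $\Gamma^{\ast}=(V,E^{-1})$ with $E^{-1}=\{(y,x)\mid (x,y)\in E\}$. Let $\Gamma=(V,E)$ be a finite digraph and $v\in V$. A vertex $w$ with $(v,w)\in E$ is called a child of $v$ (in particular, $v$ is a child of itself if it has a loop). The procreation behavior of $v$ is the sequence $(a_k)_{k\in\mathbb{N}^+}$ where $a_k$ is the number of children $c$ of $v$ such that there exists a directed path $(w_1,\ldots,w_k)$ in $\Gamma$ with $w_1=c$; here vertices on a path may repeat. For $m\in\mathbb{N}$, $\mathrm{ker}^{(m)}(\varphi)$, the $m$-th kernel of $\varphi$, is the $m$-th preimage of $\{1_G\}$ under $\varphi$, i.e. $\{g\in G\mid \varphi^m(g)=1_G\}$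 (so $\mathrm{ker}^{(0)}(\varphi)=\{1_G\}$). The empty product is $1$. *)

(* Defs.v *)
From mathcomp Require Import all_boot all_fingroup.

Set Implicit Arguments.
Unset Strict Implicit.
Unset Printing Implicit Defensive.

(* Plain MathComp. A finite digraph on V (loops allowed) is a relation on     *)
(* the finite type V; E x y means that there is an edge from x to y.          *)

Section Digraph.

Variable V : finType.
Implicit Types (E : rel V) (f : V -> V) (v c : V).

Definition state_space f : rel V := [rel x y | y == f x].

Definition dual_digraph E : rel V := [rel x y | E y x].

Definition children E v : {set V} := [set c | E v c].

(* Paths have k vertices, hence k - 1 edges, and may repeat vertices;         *)
(* sorted E w says that consecutive entries of w are joined by an edge.       *)
Definition starts_path E k c : bool :=
  [exists w : k.-tuple V, (ohead w == Some c) && sorted E w].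

(* The procreation behavior is indexed by k >= 1; its value at k = 0 is junk. *)
Definition procreation_behavior E v (k : nat) : nat :=
  #|[set c in children E v | starts_path E k c]|.

End Digraph.

Section IteratedKernel.

(* An endomorphism of a finite group, the group being the full carrier gT.    *)
Variables (gT : finGroupType) (phi : {morphism [set: gT] >-> gT}).

Definition iter_ker (m : nat) : {set gT} := [set g | iter m phi g == 1%g].

Lemma iter_ker_group_set m : group_set (iter_ker m).
Proof.
have it1 : iter m phi 1%g = 1%g by elim: m => //= m ->; rewrite morph1.
have itM : {morph iter m phi : x y / (x * y)%g}.
  by elim: m {it1} => // m IHm x y /=; rewrite IHm morphM ?inE.
apply/group_setP; split=> [|x y]; rewrite !inE ?it1 // => /eqP x1 /eqP y1.
by rewrite itM x1 y1 mulg1.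
Qed.

Canonical iter_ker_group m := Group (iter_ker_group_set m).

End IteratedKernel.

(* Main.v *)
Require Import Defs.
From mathcomp Require Import all_boot all_fingroup.

(** Reversing a directed path of the dual digraph gives a stretch of a forward
    orbit, so a child of 1 starts a path with k vertices in the dual exactly
    when it is a (k-1)-fold image under phi. Hence a_k is the order of the
    group Q_(k-1), where Q_j is the intersection of ker phi with
    im (phi ^ j) ([procreation_dual_state_space]). The groups Q_j decrease as
    j grows, so Lagrange's theorem gives a_m %| a_n for n <= m.
    On the other hand phi ^ (k-1) maps the k-th kernel onto Q_(k-1), and the
    kernel of this map is the (k-1)-st kernel; the first isomorphism theorem
    then identifies a_k with the index of consecutive kernels
    ([card_ker_cap_im_iter]), and the product formula telescopes. *)

Lemma starts_path_dual_state_space (V : finType) (f : V -> V) k c :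
  starts_path (dual_digraph (state_space f)) k.+1 c = (c \in codom (iter k f)).
Proof.
apply/existsP/codomP => [[[[|x s] //= /eqP [sz_s]] /andP[/eqP [<-]]]|[y ->]].
  rewrite -sz_s => path_s; exists (last x s).
  elim: s x path_s {sz_s} => //= y s IHs x /andP[/eqP -> /IHs <- //].
(* The walk from iter k f y is the orbit y, f y, ... listed backwards. *)
have sz_w : size (rev (traject f y k.+1)) == k.+1.
  by rewrite size_rev size_traject.
exists (Tuple sz_w); apply/andP; split.
  by rewrite -[tval _]/(rev (traject f y k.+1)) trajectSr rev_rcons.
rewrite rev_sorted /= (eq_path (e' := frel f)) ?fpath_traject // => u v /=.
exact: eq_sym.
Qed.

Section IteratedEndomorphism.

Local Open Scope group_scope.

Variables (gT : finGroupType) (phi : {morphism [set: gT] >-> gT}).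

Lemma iter_endoM k : {in [set: gT] &, {morph iter k phi : x y / x * y}}.
Proof. by elim: k => //= k IHk x y Gx Gy; rewrite IHk // morphM ?inE. Qed.

Canonical iter_endo k := Morphism (@iter_endoM k).

Definition ker_cap_im_iter k : {group gT} :=
  ('ker phi :&: iter_endo k @* [set: gT])%G.

Lemma procreation_dual_state_space k :
  procreation_behavior (dual_digraph (state_space phi)) 1 k.+1
    = #|ker_cap_im_iter k|.
Proof.
apply: eq_card => c; rewrite !inE starts_path_dual_state_space /=.
rewrite eq_sym; congr (_ && _); apply/codomP/morphimP => [[y ->]|[y _ _ ->]].
  by exists y; rewrite ?inE.
by exists y.
Qed.

Lemma ker_iter_endo k : 'ker (iter_endo k) = iter_ker phi k.
Proof. by apply/setP=> x; rewrite !inE. Qed.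

Lemma iter_kerS k : iter_ker phi k \subset iter_ker phi k.+1.
Proof. by apply/subsetP=> x; rewrite !inE /= => /eqP ->; rewrite morph1. Qed.

(** If x = phi ^ k y, then phi x = 1 says that y lies in the (k+1)-st kernel. *)
Lemma morphim_iter_ker k :
  iter_endo k @* iter_ker phi k.+1 = ker_cap_im_iter k.
Proof.
apply/setP=> x; apply/morphimP/setIP => [[y _ + ->]|[+ /morphimP[y Gy _ def_x]]].
  by rewrite !inE /= => ->; rewrite mem_morphim ?inE.
by rewrite def_x !inE => kery; exists y; rewrite ?inE.
Qed.

(** This is the first isomorphism theorem for the restriction of phi ^ k to the
    (k+1)-st kernel. *)
Lemma card_ker_cap_im_iter k :
  #|ker_cap_im_iter k| = #|iter_ker phi k.+1 : iter_ker phi k|.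
Proof. by rewrite -morphim_iter_ker card_morphim setTI ker_iter_endo. Qed.

(** For j <= k, a k-fold image is the j-fold image of a (k-j)-fold image. *)
Lemma ker_cap_im_iter_decr j k :
  j <= k -> ker_cap_im_iter k \subset ker_cap_im_iter j.
Proof.
move=> /subnKC <-; apply/setIS/subsetP => x /morphimP[y _ _ ->] /=.
by rewrite iterD mem_morphim ?inE.
Qed.

End IteratedEndomorphism.

Theorem theorem4 (gT : finGroupType) (phi : {morphism [set: gT] >-> gT}) :
  let a := procreation_behavior (dual_digraph (state_space phi)) 1%g in
  [/\ forall k : nat, \prod_(1 <= i < k.+1) a i = #|iter_ker phi k|,
      forall k : nat, 0 < k ->
        iter_ker phi k.-1 \subset iter_ker phi k
        /\ a k = #|iter_ker phi k : iter_ker phi k.-1|%g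
    & forall n m : nat, 0 < n -> 0 < m -> n <= m -> a m %| a n].
Proof.
move=> a.
have a_index k : a k.+1 = #|iter_ker phi k.+1 : iter_ker phi k|%g.
  by rewrite /a procreation_dual_state_space card_ker_cap_im_iter.
split=> [k|[//|k] _|[//|n] [//|m] _ _ le_nm].
- elim: k => [|k IHk].
    rewrite big_nil; apply/esym/eqP/cards1P; exists 1%g.
    by apply/setP=> x; rewrite !inE.
  by rewrite big_nat_recr //= IHk a_index Lagrange ?iter_kerS.
- by split; [apply: iter_kerS | apply: a_index].
- by rewrite /a !procreation_dual_state_space cardSg ?ker_cap_im_iter_decr.
Qed.
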